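(* For every positive integer $m$ and $q=6m$, there exists a code $C\subseteq B_q^4$ capable of correcting single deletions with $|C|=N(4,q,1)=\dfrac{q^2(q+2)}{4}$.
   Context: $B_q=\{0,\dots,q-1\}$ and $B_q^4$ is the set of words of length 4 over $B_q$. A code $C\subseteq B_q^4$ is capable of correcting single deletions if the sets $\lfloor x\rfloor_1$ ($x\in C$) of words obtained from $x$ by deleting one letter are pairwise disjoint (equivalently, the minimum deletion–insertion distance between distinct codewords exceeds 2). $N(4,q,1)$ is the maximum cardinality of such a code. *)

(* Defs.v *)
From mathcomp Require Import all_boot.
Set Implicit Arguments. Unset Strict Implicit. Unset Printing Implicit Defensive.

(* B_q = {0,...,q-1} is 'I_q; B_q^n is n.-tuple 'I_q. *)

Definition del_at (T : Type) (s : seq T) (i : nat) : seq T :=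
  take i s ++ drop i.+1 s.

Definition del1_set (T : Type) (x : seq T) : seq (seq T) :=
  [seq del_at x i | i <- iota 0 (size x)].

Definition single_del_code (n q : nat) (C : {set n.-tuple 'I_q}) : bool :=
  [forall x in C, forall y in C,
     (x != y) ==> ~~ has (fun w => w \in del1_set (val y)) (del1_set (val x))].

Definition N1 (n q : nat) : nat :=
  \max_(C : {set n.-tuple 'I_q} | single_del_code C) #|C|.

(* Main.v *)
From Stdlib Require Import ZArith Lia.
Require Import Defs.
From mathcomp Require Import all_boot ssrZ zify.
Set Implicit Arguments. Unset Strict Implicit. Unset Printing Implicit Defensive.

(** Deleting a letter from a word of length 4 gives triples, and a code corrects
    a deletion when no triple arises from two codewords.

    Upper bound: give the triples weights such that each codeword receives
    weight at least 4 once every word [abca] ([a], [b], [c] distinct) is granted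
    an extra 2. The words [abca] with a fixed [a] use disjoint pairs [{b, c}] among the
    [q - 1] other letters; for even [q] at least one letter is left over, which
    lowers the bound from [(q^3 + 2 q^2 + q) / 4] to [(q^3 + 2 q^2) / 4].

    Construction: the words [aabb] (with [a = b] allowed) cover all triples that
    have two equal neighbours. The others have to be partitioned, except for one
    triple [a f(a) a] per letter, into the triples of words [abcd] and [abca].
    For [q = 6 m] with [m] odd the letters are the points of [Z/3m x {0,1}].
    In general position the words are [x y z w] with [x + y = z + w] whose
    differences [x - y] and [z - w] have the same sign. Every triple of columns lies in exactly
    two of these, one for each choice of the pair of neighbours that forms a
    side of the equation, and the two are distinguished by the order of the
    differences; the majority of the three bits decides which one is used. The
    degenerate case, where one column is the midpoint of the other two, is
    settled by an explicit family, and cosets of [{0, m, 2m}] by an explicit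
    code on six letters. A doubling step [q -> 2 q] gives even [m]. *)

Definition triple (T : Type) := (T * T * T)%type.
Definition word4 (T : Type) := (T * T * T * T)%type.

Definition subs (T : Type) (w : word4 T) : seq (triple T) :=
  let: (a, b, c, d) := w in [:: (a, b, c); (a, b, d); (a, c, d); (b, c, d)].

Definition del_disjoint (T : eqType) (P : word4 T -> bool) :=
  forall x y t, P x -> P y -> t \in subs x -> t \in subs y -> x = y.

Lemma sum_triple (T : finType) (F : T -> T -> T -> nat) :
  \sum_(t : triple T) F t.1.1 t.1.2 t.2 = \sum_a \sum_b \sum_c F a b c.
Proof.
rewrite (pair_bigA _ (fun a b => \sum_c F a b c)) /=.
by rewrite (pair_bigA _ (fun p c => F p.1 p.2 c)).
Qed.

Ltac decide_eqs :=
  repeat match goal with H : is_true (?x != ?y) |- _ =>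
    let H' := fresh in
    move/negPf: H => H; have H' : (y == x) = false by [rewrite eq_sym] end.

Ltac simpl_eqs :=
  rewrite ?eqxx /=;
  repeat (match goal with H : (?x == ?y) = false |- context [?x == ?y] => rewrite H end;
          rewrite ?eqxx /=).

(** * Upper bound *)

Section UpperBound.

Variables (T : finType) (C : {set word4 T}).
Hypothesis dC : del_disjoint (fun x => x \in C).

(** After exchanging the sums, each triple is counted once per codeword that contains it, hence at
    most once by [dC]. *)
Lemma sum_subs_le (v : triple T -> nat) :
  \sum_(x in C) \sum_(t | t \in subs x) v t <= \sum_t v t.
Proof.
rewrite (exchange_big_dep predT) //=; apply: leq_sum => t _.
rewrite sum_nat_const -[leqRHS]mul1n leq_mul2r; apply/orP; right.
apply/card_le1_eqP => x y /andP[xC xt] /andP[yC yt].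
exact: dC yC xC yt xt.
Qed.

(** Values: 4 on [aaa], 2 on [aab] and [abb], 0 on [aba], 1 on three distinct letters. The initial 1
    keeps the subtraction from truncating. *)
Definition weight (t : triple T) : nat :=
  let: (a, b, c) := t in
  1 + (a == b) + (b == c) + 2 * ((a == b) && (b == c)) - (a == c).

Definition bridge (x : word4 T) : bool :=
  let: (a, b, c, d) := x in [&& a == d, b != c, b != a & c != a].

Definition peak (a : T) (t : triple T) : nat :=
  let: (b, c, d) := t in [&& b == a, d == a & c != a].

Lemma sum_subs_ge (v : triple T -> nat) (s : seq (triple T)) x :
  uniq s -> {subset s <= subs x} ->
  \sum_(t <- s) v t <= \sum_(t | t \in subs x) v t.
Proof.
move=> us ss; rewrite [leqLHS]big_uniq // [leqRHS](bigID (fun t => t \in s)) /=.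
apply: leq_trans (leq_addr _ _); rewrite leq_eqVlt; apply/orP; left; apply/eqP.
by apply: eq_bigl => t; case: (boolP (t \in s)) => [/ss ->|_]; rewrite ?andbF.
Qed.

(** Only the equalities among the four letters matter. A bridge [abca] has triples of weights 1, 0,
    0, 1 and needs the extra 2; every other pattern reaches 4 by itself. *)
Lemma weight_word x :
  4 <= (\sum_(t | t \in subs x) weight t) + 2 * bridge x.
Proof.
have H s : uniq s -> {subset s <= subs x} -> 4 <= (\sum_(t <- s) weight t) + 2 * bridge x ->
    4 <= (\sum_(t | t \in subs x) weight t) + 2 * bridge x.
  by move=> us ss h; apply: leq_trans h _; rewrite leq_add2r; exact: sum_subs_ge.
(* [subs] repeats triples on words such as [aabb], whereas the sum counts each triple once. *)
apply: (H (undup (subs x))); rewrite ?undup_uniq //.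
  by move=> t; rewrite mem_undup.
case: x {H} => [[[a b] c] d]; rewrite /subs /bridge.
have pE (p q r p' q' r' : T) : ((p, q, r) == (p', q', r')) = [&& p == p', q == q' & r == r'].
  by rewrite !xpair_eqE andbA.
have [?|ab] := eqVneq a b; [subst b|]; (have [?|ac] := eqVneq a c; [subst c|]);
  (have [?|ad] := eqVneq a d; [subst d|]);
  try (have [?|bc] := eqVneq b c; [subst c|]); try (have [?|bd] := eqVneq b d; [subst d|]);
  try (have [?|cd] := eqVneq c d; [subst d|]);
  decide_eqs; rewrite /= !inE !pE /=; simpl_eqs; rewrite ?big_cons ?big_nil /=; simpl_eqs; done.
Qed.

Hypothesis evT : ~~ odd #|T|.

Lemma card_bridge a : 2 * #|[set x in C | bridge x & x.1.1.1 == a]| <= #|T| - 2.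
Proof.
set B := [set x in C | _].
have h1 : 2 * #|B| <= \sum_t peak a t.
  apply: leq_trans (sum_subs_le _).
  rewrite mulnC -sum_nat_const [leqRHS](big_setID B) /=; apply: leq_trans (leq_addr _ _).
  rewrite (setIidPr _); last by apply/subsetP => x; rewrite !inE => /andP[].
  apply: leq_sum => -[[[p q] r] s]; rewrite !inE /= => /andP[_ /andP[/and4P[/eqP<- qr qp rp] /eqP pa]].
  have := @sum_subs_ge (peak a) [:: (p, q, p); (p, r, p)] (p, q, r, p).
  move=> H; apply: leq_trans (H _ _).
  - by rewrite !big_cons big_nil /= pa eqxx -{1}pa qp -pa rp.
  - by rewrite /= inE !xpair_eqE eqxx (negPf qr).
  - by move=> t; rewrite !inE => /orP[]/eqP->; rewrite !eqxx ?orbT.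
have h2 : \sum_t peak a t = #|T|.-1.
  rewrite (eq_bigr (fun t => nat_of_bool (t \in [set (a, c, a) | c in [set~ a]]))); last first.
    move=> [[b c] d] _ /=; congr nat_of_bool; apply/and3P/imsetP.
      by case=> /eqP-> /eqP-> ca; exists c; rewrite ?inE.
    by case=> e; rewrite !inE => ea [-> -> ->].
  rewrite -big_mkcond sum1_card card_imset ?cardsC1 // => x y [].
  by [].
(* [2 * #|B|] is even and [#|T|.-1] is odd, which gains one. *)
move: h1; rewrite h2; move: evT; lia.
Qed.

Lemma sum_weight : \sum_t weight t = #|T| ^ 3 + #|T| ^ 2 + 2 * #|T|.
Proof.
pose q := #|T|.
have sum1 (a : T) : \sum_b (a == b : nat) = 1.
  by rewrite (bigD1 a) //= eqxx big1 // => b /negPf; rewrite eq_sym => ->.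
have sumk k (a : T) : \sum_b (a == b) * k = k.
  by rewrite (bigD1 a) //= eqxx mul1n big1 ?addn0 // => b /negPf; rewrite eq_sym => ->.
have sumc (k : nat) : \sum_(a : T) k = q * k by rewrite sum_nat_const.
(* The subtracted terms [a == c] sum to [q ^ 2]; adding them to both sides removes the
   subtraction. *)
have e1 : \sum_t weight t + q ^ 2 = q ^ 3 + q ^ 2 + q ^ 2 + 2 * q.
  rewrite -[q ^ 2 in LHS]mulnn -[q * q]muln1.
  have -> : q * q * 1 = \sum_(t : triple T) (t.1.1 == t.2 : nat).
    rewrite (sum_triple (fun a b c => (a == c : nat))).
    under eq_bigr do under eq_bigr do rewrite sum1.
    by rewrite !sumc mulnA.
  rewrite -big_split /=.
  rewrite (eq_bigr (fun t : triple T => 1 + (t.1.1 == t.1.2) + (t.1.2 == t.2)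
     + ((t.1.1 == t.1.2) && (t.1.2 == t.2)) * 2)); last first.
    move=> [[a b] c] _ /=; rewrite subnK mulnC //; case: eqP => // _; exact: leq_trans (leq_addr _ _).
  rewrite (sum_triple (fun a b c => 1 + (a == b) + (b == c) + ((a == b) && (b == c)) * 2)).
  have E (a b : T) : \sum_c (1 + (a == b) + (b == c) + ((a == b) && (b == c)) * 2)
      = q + (a == b) * q + 1 + (a == b) * 2.
    rewrite !big_split /= !sumc sum1 muln1 [q * _]mulnC; congr (_ + _).
    by case: (a == b) => /=; rewrite ?sumk // big1.
  under eq_bigr do (under eq_bigr do rewrite E).
  under eq_bigr do rewrite !big_split /= !sumk !sumc.
  rewrite !sumc !expnS expn0; lia.
by apply: (@addIn (q ^ 2)); rewrite e1 /q addnAC.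
Qed.

Theorem del_code_upper_bound : #|C| * 4 <= #|T| ^ 3 + 2 * #|T| ^ 2.
Proof.
have h1 : #|C| * 4 <= \sum_(x in C) ((\sum_(t | t \in subs x) weight t) + 2 * bridge x).
  by rewrite -sum_nat_const; apply: leq_sum => x _; exact: weight_word.
have h2 : \sum_(x in C) 2 * bridge x <= #|T| * (#|T| - 2).
  rewrite -sum_nat_const (partition_big (fun x : word4 T => x.1.1.1) predT) //=.
  apply: leq_sum => a _; apply: leq_trans (card_bridge a).
  rewrite -big_distrr /= leq_mul2l /= -sum1_card.
  rewrite [leqRHS](eq_bigl (fun x => [&& x \in C, bridge x & x.1.1.1 == a])); last first.
    by move=> x; rewrite !inE.
  rewrite big_mkcondr /= [leqRHS]big_mkcondr /=; apply: leq_sum => x _.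
  by case: (bridge x); case: (_ == a).
move: h1; rewrite big_split /= => h1; have h3 := sum_subs_le weight.
rewrite sum_weight in h3.
apply: leq_trans h1 _; apply: leq_trans (leq_add h3 h2) _.
(* [#|T| - 2] is a true difference only from 2 on: the empty alphabet is treated apart, and size 1
   is excluded by parity. *)
have [->//|T0] := posnP #|T|.
have T2 : 2 <= #|T| by move: evT T0; case: #|T| => [|[]].
have -> : 2 * #|T| ^ 2 = #|T| ^ 2 + (2 * #|T| + #|T| * (#|T| - 2)).
  by rewrite mul2n -addnn [2 * _]mulnC -mulnDr subnKC // mulnn.
by rewrite !addnA.
Qed.

End UpperBound.

(** * Codes from a partition of the triples without equal neighbours *)

(* [f] names the triple [a f(a) a] that is given up for the letter [a]. *)
Definition core_triple (T : eqType) (f : T -> T) (t : triple T) : bool :=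
  let: (a, b, c) := t in [&& a != b, b != c & ~~ ((a == c) && (b == f a))].

Definition all4 (T : Type) (D : T -> bool) (w : word4 T) : bool :=
  let: (a, b, c, d) := w in [&& D a, D b, D c & D d].

(** The words of [W] partition the core triples over the letters in [D]. A predicate on an [eqType]
    allows integers as letters; finiteness enters only with an enumeration of [D]. *)
Definition core_code (T : eqType) (D : T -> bool) (f : T -> T) (W : word4 T -> bool) :=
  [/\ forall a, D a -> [/\ D (f a), f a != a & f (f a) = a],
      forall w, W w -> all4 D w,
      forall w t, W w -> t \in subs w -> core_triple f t,
      forall a b c, D a -> D b -> D c -> core_triple f (a, b, c) ->
        exists2 w, W w & (a, b, c) \in subs w
    & del_disjoint W].

Definition full_code (T : eqType) (W : word4 T -> bool) (w : word4 T) : bool :=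
  let: (a, b, c, d) := w in (a == b) && (c == d) || W w.

(** Any two positions except the first and the last become neighbours in some triple, so [a = d] is
    the only equality left open. *)
Lemma core_neq (T : eqType) (f : T -> T) (W : word4 T -> bool) a b c d :
  (forall w t, W w -> t \in subs w -> core_triple f t) -> W (a, b, c, d) ->
  [/\ a != b, b != c, c != d, a != c & b != d].
Proof.
move=> H Ww; have Hs := H _ _ Ww.
have /and3P[ab bc _] := Hs (a, b, c) (mem_head _ _).
have /and3P[_ bd _] : core_triple f (a, b, d) by apply: Hs; rewrite !inE eqxx ?orbT.
have /and3P[ac cd _] : core_triple f (a, c, d) by apply: Hs; rewrite !inE eqxx ?orbT.
by [].
Qed.

(** Triples of [aabb] have two equal neighbours and triples of [W] have none, so only words of the
    same kind could share one. *)
Lemma full_code_del_disjoint (T : eqType) D f (W : word4 T -> bool) :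
  core_code D f W -> del_disjoint (full_code W).
Proof.
case=> _ _ Wc _ dW.
have low w t : W w -> t \in subs w -> (t.1.1 != t.1.2) /\ (t.1.2 != t.2).
  by move=> Ww /(Wc _ _ Ww); case: t => [[a b] c] /and3P[].
have flow (t : triple T) a b : t \in subs (a, a, b, b) -> (t.1.1 == t.1.2) || (t.1.2 == t.2).
  by rewrite !inE => /or4P[]/eqP->; rewrite /= eqxx ?orbT.
move=> [[[a b] c] d] [[[a' b'] c'] d'] t
  /orP[/andP[/eqP ab /eqP cd]|Ww] /orP[/andP[/eqP ab' /eqP cd']|Ww'].
- subst b d b' d'; rewrite !inE => /or4P[]/eqP-> /or4P[]/eqP[]; intros; subst; done.
- subst b d => tw tw'; have [/negPf h1 /negPf h2] := low _ _ Ww' tw'.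
  by have := flow _ a c tw; rewrite h1 h2.
- subst b' d' => tw tw'; have [/negPf h1 /negPf h2] := low _ _ Ww tw.
  by have := flow _ a' c' tw'; rewrite h1 h2.
- exact: dW Ww Ww'.
Qed.

(** * Cardinality of the code *)

Section Counting.

Variables (T : finType) (f : T -> T) (W : word4 T -> bool).
Hypothesis cW : core_code xpredT f W.

Lemma card_core_triple : #|[set t : triple T | core_triple f t]| + #|T| = #|T| * #|T|.-1 ^ 2.
Proof.
have [fP _ _ _ _] := cW.
pose X := [set (a, f a, a) | a in [set: T]] : {set triple T}.
have cX : #|X| = #|T| by rewrite card_imset ?cardsT // => a b [].
rewrite -{1}cX.
have -> : #|[set t : triple T | core_triple f t]| + #|X| =
    #|[set t : triple T | (t.1.1 != t.1.2) && (t.1.2 != t.2)]|.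
  rewrite -(cardsID X [set t : triple T | (t.1.1 != t.1.2) && (t.1.2 != t.2)]) addnC; congr (_ + _).
    rewrite (setIidPr _) //; apply/subsetP => t /imsetP[a _ ->]; rewrite inE /=.
    by have [_ h _] := fP a isT; rewrite h eq_sym h.
  apply: eq_card => -[[a b] c]; rewrite !inE /=.
  have -> : (a, b, c) \in X = (a == c) && (b == f a).
    apply/imsetP/andP; first by case=> x _ [-> -> ->].
    by case=> /eqP<- /eqP->; exists a.
  by rewrite andbA andbC.
rewrite -sum1dep_card.
rewrite (eq_bigl (fun t : triple T => predT t && ((t.1.1 != t.1.2) && (t.1.2 != t.2)))) //.
rewrite big_mkcondr /= (sum_triple (fun a b c => if (a != b) && (b != c) then 1 else 0)).
rewrite exchange_big /=.
under eq_bigr => b _.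
  under eq_bigr => a _ do rewrite -big_mkcond sum1dep_card.
  over.
rewrite -sum_nat_const; apply: eq_bigr => b _.
rewrite -mulnn -[X in X * _](cardC1 b) -sum_nat_const [RHS]big_mkcond /=.
apply: eq_bigr => a _; rewrite !inE; case: (a != b) => /=; last exact: cards0.
by rewrite -(cardC1 b); apply: eq_card => c; rewrite !inE eq_sym.
Qed.

(** Double counting: by [core_neq] a word has four different triples, and each core triple lies in
    exactly one word. *)
Lemma card_core_code : #|[set w | W w]| * 4 = #|[set t : triple T | core_triple f t]|.
Proof.
have [_ _ Wc Wx dW] := cW.
rewrite -sum_nat_const -sum1dep_card.
rewrite (eq_bigr (fun w => \sum_(t | t \in subs w) 1)); last first.
  move=> [[[a b] c] d]; rewrite inE => Ww; rewrite sum1_card.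
  have [ab bc cd ac bd] := core_neq Wc Ww.
  have /card_uniqP -> // : uniq (subs (a, b, c, d)).
  by rewrite /= !inE !xpair_eqE (negPf ab) (negPf bc) (negPf cd) !andbF.
rewrite (exchange_big_dep (core_triple f)) /=; last first.
  by move=> w t; rewrite inE; exact: Wc.
apply: eq_bigr => -[[a b] c] ct; rewrite sum1_card.
have [w Ww tw] := Wx a b c isT isT isT ct.
rewrite -(card1 w); apply: eq_card => x; rewrite !inE unfold_in /= inE.
apply/andP/eqP => [[Wx' tx]|->//]; exact: dW Wx' Ww tx tw.
Qed.

(** With [q] letters there are [q ^ 2] words [aabb] and [q (q - 1) ^ 2 - q] core triples, and [4 q ^
    2 + q (q - 1) ^ 2 - q = q ^ 3 + 2 q ^ 2]. *)
Lemma card_full_code : 1 < #|T| -> #|[set w | full_code W w]| * 4 = #|T| ^ 3 + 2 * #|T| ^ 2.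
Proof.
have [_ _ Wc _ _] := cW.
move=> T1.
pose X := [set (p.1, p.1, p.2, p.2) | p in [set: T * T]] : {set word4 T}.
have cX : #|X| = #|T| * #|T|.
  by rewrite card_imset ?cardsT ?card_prod // => -[a b] [c d] [_ -> _ ->].
have -> : [set w | full_code W w] = X :|: [set w | W w].
  apply/setP => -[[[a b] c] d]; rewrite !inE; congr (_ || _).
  apply/andP/imsetP => [[/eqP<- /eqP<-]|[[x y] _ [-> -> -> ->]]]; last by [].
  by exists (a, c).
rewrite cardsU disjoint_setI0 ?cards0 ?subn0; last first.
  rewrite disjoint_subset; apply/subsetP => w /imsetP[[a b] _ ->]; rewrite !inE /=.
  by apply/negP => /(core_neq Wc) []; rewrite eqxx.
have h1 := card_core_triple; have h2 := card_core_code.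
rewrite mulnDl h2 cX; apply: (@addIn #|T|); rewrite -addnA h1.
by case: #|T| T1 => // q _; rewrite /= !expnS expn0; lia.
Qed.

End Counting.

(** * Translation to tuples and to [N1] *)

Definition tuple_of_word (T : Type) (w : word4 T) : 4.-tuple T :=
  let: (a, b, c, d) := w in [tuple a; b; c; d].

Lemma tuple_of_word_bij (T : Type) : bijective (@tuple_of_word T).
Proof.
exists (fun x => (tnth x (inord 0), tnth x (inord 1), tnth x (inord 2), tnth x (inord 3))).
  by move=> [[[a b] c] d] /=; rewrite !(tnth_nth a) /= !inordK.
case/tupleP=> a x; case/tupleP: x => b x; case/tupleP: x => c x; case/tupleP: x => d x.
by rewrite (tuple0 x) /= !(tnth_nth a) /= !inordK //; apply: val_inj.
Qed.

(** Deleting at index 0 gives the last triple of [subs], whence the reversal. *)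
Lemma del1_set_word (T : eqType) (w : word4 T) :
  del1_set (tuple_of_word w) = rev [seq [:: t.1.1; t.1.2; t.2] | t <- subs w].
Proof. by case: w => [[[a b] c] d]. Qed.

Lemma single_del_codeP (q : nat) (C : {set 4.-tuple 'I_q}) :
  reflect (del_disjoint (fun w => tuple_of_word w \in C)) (single_del_code C).
Proof.
apply: (iffP idP) => [sC x y t xC yC tx ty|dC].
  move/forall_inP/(_ _ xC)/forall_inP/(_ _ yC): sC.
  have [/(bij_inj (@tuple_of_word_bij _)) //|_ /=] := eqVneq; case/hasP.
  exists [:: t.1.1; t.1.2; t.2]; rewrite !del1_set_word mem_rev; exact: map_f.
apply/forall_inP => x xC; apply/forall_inP => y yC; apply/implyP; apply: contra.
have [g gK Kg] := @tuple_of_word_bij 'I_q.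
rewrite -(Kg x) -(Kg y) in xC yC *; rewrite !del1_set_word => /hasP[u].
rewrite !mem_rev => /mapP[t tx ->] /mapP[t' ty] tt'.
suff E : t = t' by rewrite (dC _ _ t xC yC tx) // E.
by case: t t' tt' {tx ty} => [[a b] c] [[a' b'] c'] /= [-> -> ->].
Qed.

Lemma card_word_set (T : finType) (C : {set 4.-tuple T}) :
  #|[set w | tuple_of_word w \in C]| = #|C|.
Proof. exact: on_card_preimset (onW_bij _ (@tuple_of_word_bij T)). Qed.

(** The size of [full_code W] equals the bound of [del_code_upper_bound], so this code is
    optimal. *)
Lemma N1_of_core (q : nat) f (W : word4 'I_q -> bool) :
  1 < q -> ~~ odd q -> core_code xpredT f W ->
  exists C : {set 4.-tuple 'I_q},
    [/\ single_del_code C, #|C| = N1 4 q & N1 4 q = (q ^ 2 * (q + 2)) %/ 4].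
Proof.
move=> q1 evq cW.
have [g gK Kg] := @tuple_of_word_bij 'I_q.
pose C := [set x | full_code W (g x)].
have eC w : (tuple_of_word w \in C) = full_code W w by rewrite inE gK.
have sC : single_del_code C.
  apply/single_del_codeP => x y t; rewrite !eC.
  exact: (full_code_del_disjoint cW).
have nC : #|C| = (q ^ 2 * (q + 2)) %/ 4.
  have := card_full_code cW; rewrite card_ord => /(_ q1).
  have -> : [set w | full_code W w] = [set w | tuple_of_word w \in C].
    by apply/setP => w; rewrite in_set [RHS]in_set eC.
  rewrite card_word_set.
  have -> : q ^ 2 * (q + 2) = q ^ 3 + 2 * q ^ 2 by rewrite mulnDr mulnC -expnS mulnC [2 * _]mulnC.
  by move=> <-; rewrite mulnK.
have mC : N1 4 q = #|C|.
  apply/eqP; rewrite eqn_leq; apply/andP; split; last first.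
    by rewrite /N1; apply: (bigmax_sup C).
  apply/bigmax_leqP => B /single_del_codeP dB.
  rewrite -card_word_set nC leq_divRL //.
  have dB' : del_disjoint (fun w => w \in [set w | tuple_of_word w \in B]).
    by move=> x y t; rewrite !inE; exact: dB.
  have := del_code_upper_bound dB'; rewrite card_ord => /(_ evq).
  by rewrite mulnDr -expnSr [_ * 2]mulnC.
by exists C; rewrite mC.
Qed.

(** * Transport of core codes to ordinals *)

Definition map4 (T U : Type) (e : T -> U) (w : word4 T) : word4 U :=
  let: (a, b, c, d) := w in (e a, e b, e c, e d).

Definition map3 (T U : Type) (e : T -> U) (t : triple T) : triple U :=
  let: (a, b, c) := t in (e a, e b, e c).

Lemma subs_map4 (T U : Type) (e : T -> U) w : subs (map4 e w) = map (map3 e) (subs w).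
Proof. by case: w => [[[a b] c] d]. Qed.

Lemma map3_inj (T U : Type) (e : T -> U) : injective e -> injective (map3 e).
Proof. by move=> ei [[a b] c] [[a' b'] c'] [/ei-> /ei-> /ei->]. Qed.

Lemma map4_inj (T U : Type) (e : T -> U) : injective e -> injective (map4 e).
Proof. by move=> ei [[[a b] c] d] [[[a' b'] c'] d'] [/ei-> /ei-> /ei-> /ei->]. Qed.

Lemma core_code_ord (T : eqType) (D : T -> bool) f W (s : seq T) :
  core_code D f W -> uniq s -> s =i D ->
  exists (f' : 'I_(size s) -> 'I_(size s)) W', core_code xpredT f' W'.
Proof.
case=> fP WD Wc Wx dW us sD.
pose e := tnth (in_tuple s).
have ei : injective e by apply/tuple_uniqP.
have De i : D (e i) by rewrite -[D _]sD; apply: mem_tnth.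
(* An informative existence statement, since [f'] is computed from it. *)
have eD x : D x -> {i | e i == x}.
  rewrite -[D x]sD => xs; have xs' := xs; rewrite -index_mem in xs'.
  by exists (Ordinal xs'); rewrite /e (tnth_nth x) /= nth_index.
pose f' i := sval (eD _ (let: And3 h _ _ := fP _ (De i) in h)).
have fe i : e (f' i) = f (e i) by rewrite /f'; case: (eD _ _) => j /= /eqP.
have ce t : core_triple f (map3 e t) = core_triple f' t.
  by case: t => [[a b] c]; rewrite /= -fe !(inj_eq ei).
exists f', (fun w => W (map4 e w)); split.
- move=> a _; have [_ h1 h2] := fP _ (De a); split => //.
    by rewrite -(inj_eq ei) fe.
  by apply: ei; rewrite !fe.
- by move=> [[[a b] c] d].
- move=> w t Ww tw; rewrite -ce; apply: Wc Ww _; rewrite subs_map4; exact: map_f.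
- move=> a b c _ _ _; rewrite -ce => /Wx[] // w Ww tw.
  have : all4 D w by exact: WD.
  case: w Ww tw => [[[x y] z] u] Ww tw /and4P[Dx Dy Dz Du].
  case: (eD _ Dx) (eD _ Dy) (eD _ Dz) (eD _ Du) => [i /eqP ix] [j /eqP jy] [k /eqP kz] [l /eqP lu].
  exists (i, j, k, l); first by rewrite /= ix jy kz lu.
  rewrite -(mem_map (map3_inj ei)) -subs_map4 /= ix jy kz lu; exact: tw.
- move=> x y t Wx' Wy tx ty; apply: (map4_inj ei).
  by apply: (dW _ _ (map3 e t)) => //; rewrite subs_map4 map_f.
Qed.

(** * Doubling the alphabet *)

Section Doubling.

Variables (T : eqType) (D : T -> bool) (f : T -> T) (W : word4 T -> bool).
Hypothesis cW : core_code D f W.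

Definition flip (U : Type) (x : U * bool) : U * bool := (x.1, ~~ x.2).

(** Even parity lets any three of the bits determine the fourth. *)
Definition lift_word (w : word4 (T * bool)) : bool :=
  let: (p, q, r, s) := w in
  W (map4 fst w) && ~~ (p.2 (+) q.2 (+) r.2 (+) s.2).

Definition cross_word (w : word4 (T * bool)) : bool :=
  let: (p, q, r, s) := w in
  [&& D p.1, D r.1, r.1 != p.1, r.1 != f p.1 & w == (p, flip p, (r.1, p.2), (r.1, ~~ p.2))].

(* Half of an optimal set of eight words on the four letters over [a] and [f a];
   exchanging [a] and [f a] gives the other half. *)
Definition pair_words (a : T) : seq (word4 (T * bool)) :=
  let b := f a in
  [:: ((a, false), (b, false), (b, true), (a, false));
      ((a, true), (b, false), (b, true), (a, true));
      ((a, false), (b, true), (b, false), (a, true));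
      ((a, true), (b, true), (a, false), (b, false))].

Definition pair_word (w : word4 (T * bool)) : bool :=
  let: (p, _, _, _) := w in D p.1 && (w \in pair_words p.1).

Definition double_word (w : word4 (T * bool)) : bool :=
  [|| lift_word w, cross_word w | pair_word w].

Definition cross_columns (t : triple T) : bool :=
  let: (a, b, c) := t in
  (a == b) && (c \notin [:: a; f a]) || (b == c) && (a \notin [:: b; f b]).

(** A decoder that recovers a cross word from each of its triples. It reduces disjointness to an
    equation and supplies the witness for coverage; [pair_dec] and [outer_dec] serve the same
    purpose. *)
Definition cross_dec (t : triple (T * bool)) : word4 (T * bool) :=
  let: ((a, i), (b, j), (c, k)) := t in
  if a == b then ((a, i), (a, ~~ i), (c, i), (c, ~~ i))
  else ((a, j), (a, ~~ j), (c, j), (c, ~~ j)).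

Definition pair_dec (t : triple (T * bool)) : word4 (T * bool) :=
  let: ((a, i), (b, j), (c, k)) := t in
  if a == c then
    if i == k then ((a, i), (b, false), (b, true), (a, i))
    else if k then ((a, false), (b, true), (b, false), (a, true))
    else if j then ((a, true), (b, true), (a, false), (b, false))
    else ((b, true), (a, true), (b, false), (a, false))
  else if a == b then
    if i then
      if k then ((c, false), (a, true), (a, false), (c, true))
      else ((a, true), (c, true), (a, false), (c, false))
    else ((c, k), (a, false), (a, true), (c, k))
  else
    if j then
      if i then ((a, true), (b, true), (a, false), (b, false))
      else ((a, false), (b, true), (b, false), (a, true))
    else ((a, i), (b, false), (b, true), (a, i)).

Lemma lift_columns w t : lift_word w -> t \in subs w -> core_triple f (map3 fst t).
Proof.
have [_ _ Wc _ _] := cW.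
case: w => [[[p q] r] s] /andP[Ww _] tw; apply: (Wc _ _ Ww).
rewrite subs_map4; exact: map_f.
Qed.

Lemma fK a : D a -> f (f a) = a. Proof. by have [fP _ _ _ _] := cW; case/fP. Qed.
Lemma f_neq a : D a -> (f a == a) = false.
Proof. by have [fP _ _ _ _] := cW; case/fP => _ /negPf. Qed.
Lemma fD a : D a -> D (f a). Proof. by have [fP _ _ _ _] := cW; case/fP. Qed.

(** The column patterns separate this family from the lifted words and the pair words; the decoder
    separates its members. *)
Lemma cross_wordP w t : cross_word w -> t \in subs w ->
  [/\ cross_columns (map3 fst t), ~~ core_triple f (map3 fst t),
      core_triple (@flip T) t & cross_dec t = w].
Proof.
case: w => [[[[a i] q] [c k]] s] /and5P[/= Da Dc ca cfa /eqP[-> -> ->]].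
have fca : (a == f c) = false by apply: contraNF cfa => /eqP ->; rewrite fK.
have ac : (a == c) = false by rewrite eq_sym (negPf ca).
rewrite !inE => /or4P[]/eqP->; rewrite /= !inE ?eqxx ?ca ?cfa ?(negPf ca) ?(negPf cfa) ?fca ?ac;
  rewrite ?xpair_eqE ?eqxx ?(negPf ca) ?ac ?negbK /=; split=> //; by case: i.
Qed.

Lemma pair_wordP w t : pair_word w -> t \in subs w ->
  [/\ ~~ cross_columns (map3 fst t), ~~ core_triple f (map3 fst t),
      core_triple (@flip T) t & pair_dec t = w].
Proof.
case: w => [[[[a i] q] r] s] /andP[/= Da]; rewrite !inE.
have faa := f_neq Da; have afa : (a == f a) = false by rewrite eq_sym.
have ffa := fK Da.
by case/or4P => /eqP[-> -> -> ->] /or4P[] /eqP->;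
  rewrite /= !inE ?xpair_eqE ?ffa ?faa ?afa ?eqxx /=.
Qed.

Lemma lift_word_core w t : lift_word w -> t \in subs w -> core_triple (@flip T) t.
Proof.
move=> Ww tw; have := lift_columns Ww tw.
case: t {tw} => [[[a i] [b j]] [c k]] /= /and3P[ab bc _].
by rewrite !xpair_eqE (negPf ab) (negPf bc) /= [b == a]eq_sym (negPf ab) !andbF.
Qed.

(** The columns agree because [W] is disjoint. By [core_neq] they fix the positions of the triple,
    so three bits agree, and parity gives the fourth. *)
Lemma lift_word_disjoint : del_disjoint lift_word.
Proof.
have [_ _ Wc _ dW] := cW.
move=> x y t Lx Ly tx ty.
have : map4 fst x = map4 fst y.
  apply: (dW _ _ (map3 fst t)); rewrite ?subs_map4 ?map_f //.
    by case: x Lx {tx} => [[[p q] r] s] /andP[].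
  by case: y Ly {ty} => [[[p q] r] s] /andP[].
case: x y Lx Ly tx ty => [[[[a i] [b j]] [c k]] [d l]] [[[[a' i'] [b' j']] [c' k']] [d' l']].
move=> /andP[/= Wx /negPf px] /andP[/= Wy /negPf py] tx ty [? ? ? ?]; subst a' b' c' d'.
have [/eqP ab /eqP bc /eqP cd /eqP ac /eqP bd] := core_neq Wc Wx.
move: tx ty; rewrite !inE => /or4P[]/eqP-> /or4P[]/eqP[]; intros; subst => //;
  move: px py; repeat match goal with b : ?S |- _ => unify S bool; destruct b end => //.
Qed.

Lemma core_code_double : core_code (fun x => D x.1) (@flip T) double_word.
Proof.
have [fP WD Wc Wx dW] := cW; split.
- by move=> [a i] /= Da; rewrite /flip /= negbK xpair_eqE eqxx; split => //; case: i.
- move=> [[[p q] r] s] /or3P[/andP[/WD]|/and5P[Dp Dr _ _ /eqP[-> -> ->]]|/andP[Dp]] //=.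
    by rewrite Dp Dr.
  by rewrite !inE => /or4P[]/eqP[_ -> -> ->] /=; rewrite Dp !fD.
- move=> w t /or3P[|/cross_wordP h|/pair_wordP h] tw; [|by case: (h _ tw)|by case: (h _ tw)].
  by move/lift_word_core; apply.
- move=> [a i] [b j] [c k] /= Da Db Dc; rewrite !xpair_eqE => /and3P[ab bc exc].
  (* Equal neighbouring columns lead to a pair word or a cross word, according to whether the other
     column is the partner under [f]. Otherwise columns [a f(a) a] give a pair word, and the rest
     form a core triple that is lifted. *)
  have [eab|nab] := eqVneq a b; last have [ebc|nbc] := eqVneq b c.
  + subst b; have {ab} ij : j = ~~ i by move: ab; rewrite eqxx; case: i j {bc exc} => [] [].
    subst j; have [eac|nac] := eqVneq a c.
      by move: bc exc; subst c; rewrite !eqxx /=; case: i k => [] [].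
    have [cfa|ncfa] := eqVneq c (f a).
      exists (pair_dec ((a, i), (a, ~~ i), (c, k))).
        rewrite /double_word; apply/or3P; apply: Or33; rewrite /= (negPf nac) eqxx.
        by subst c; case: i k {bc exc} => [] []; rewrite /= ?Da ?fD // /pair_words ?fK // ?inE ?eqxx ?orbT.
      by rewrite /= (negPf nac) eqxx; case: i k {bc exc} => [] []; rewrite !inE eqxx ?orbT.
    exists (cross_dec ((a, i), (a, ~~ i), (c, k))).
      rewrite /double_word; apply/or3P; apply: Or32; rewrite /= eqxx /= Da Dc ncfa eqxx !andbT.
      by rewrite eq_sym.
    by rewrite /= eqxx; case: i k {bc exc} => [] []; rewrite !inE eqxx ?orbT.
  + subst c; have {bc} jk : k = ~~ j by move: bc; rewrite eqxx; case: j k {ab exc} => [] [].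
    subst k; have [bfa|nbfa] := eqVneq b (f a).
      exists (pair_dec ((a, i), (b, j), (b, ~~ j))).
        rewrite /double_word; apply/or3P; apply: Or33; rewrite /= (negPf nab).
        by subst b; case: i j {ab exc} => [] []; rewrite /= ?Da ?fD // /pair_words ?fK // ?inE ?eqxx ?orbT.
      by rewrite /= (negPf nab); case: i j {ab exc} => [] []; rewrite !inE eqxx ?orbT.
    exists (cross_dec ((a, i), (b, j), (b, ~~ j))).
      rewrite /double_word; apply/or3P; apply: Or32; rewrite /= (negPf nab) /= Da Db nbfa eqxx !andbT.
      by rewrite eq_sym.
    by rewrite /= (negPf nab); case: i j {ab exc} => [] []; rewrite !inE eqxx ?orbT.
  + have [/andP[/eqP ac /eqP bfa]|ncore] := boolP ((a == c) && (b == f a)).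
      subst c; exists (pair_dec ((a, i), (b, j), (a, k))).
        rewrite /double_word; apply/or3P; apply: Or33; rewrite /= eqxx.
        by subst b; case: i j k {ab bc exc} => [] [] []; rewrite /= ?Da ?fD // /pair_words ?fK // ?inE ?eqxx ?orbT.
      by rewrite /= eqxx; case: i j k {ab bc exc} => [] [] []; rewrite !inE eqxx ?orbT.
    have [|[[[p q] r] s] Ww] := Wx a b c Da Db Dc; first by rewrite /= nab nbc.
    rewrite !inE => /or4P[]/eqP[? ? ?]; subst.
    (* In all four positions the missing bit is the one that makes the parity even. *)
    * exists ((p, i), (q, j), (r, k), (s, i (+) j (+) k)); last by rewrite !inE eqxx.
      by rewrite /double_word /= Ww; case: i j k {ab bc exc} => [] [] [].
    * exists ((p, i), (q, j), (r, i (+) j (+) k), (s, k)); last by rewrite !inE eqxx ?orbT.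
      by rewrite /double_word /= Ww; case: i j k {ab bc exc} => [] [] [].
    * exists ((p, i), (q, i (+) j (+) k), (r, j), (s, k)); last by rewrite !inE eqxx ?orbT.
      by rewrite /double_word /= Ww; case: i j k {ab bc exc} => [] [] [].
    * exists ((p, i (+) j (+) k), (q, i), (r, j), (s, k)); last by rewrite !inE eqxx ?orbT.
      by rewrite /double_word /= Ww; case: i j k {ab bc exc} => [] [] [].
- move=> x y t /or3P[Lx|Cx|Px] /or3P[Ly|Cy|Py] tx ty.
  + exact: lift_word_disjoint tx ty.
  + by have [_ /negP[]] := cross_wordP Cy ty; apply: lift_columns tx.
  + by have [_ /negP[]] := pair_wordP Py ty; apply: lift_columns tx.
  + by have [_ /negP[]] := cross_wordP Cx tx; apply: lift_columns ty.
  + by have [_ _ _ <-] := cross_wordP Cx tx; have [_ _ _ <-] := cross_wordP Cy ty.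
  + by have [h _ _ _] := cross_wordP Cx tx; have [/negP[]] := pair_wordP Py ty.
  + by have [_ /negP[]] := pair_wordP Px tx; apply: lift_columns ty.
  + by have [h _ _ _] := cross_wordP Cy ty; have [/negP[]] := pair_wordP Px tx.
  + by have [_ _ _ <-] := pair_wordP Px tx; have [_ _ _ <-] := pair_wordP Py ty.
Qed.

End Doubling.

(** * The alphabet Z/3m x {0,1} for odd m *)

Section Base.

Variables m h : Z.
Hypothesis mh : (3 * m = 2 * h + 1)%Z.
Hypothesis m0 : (0 < m)%Z.

Local Notation n := (3 * m)%Z.

(* The representative of [x - y] modulo [3m] in [[-h, h]]. *)
Definition sdiff (x y : Z) : Z :=
  if (h <? x - y)%Z then (x - y - n)%Z
  else if (x - y <? - h)%Z then (x - y + n)%Z else (x - y)%Z.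

(* [a + b - c] modulo [3m], for representatives in [[0, 3m)]. *)
Definition mirror (a b c : Z) : Z :=
  if (a + b - c <? 0)%Z then (a + b - c + n)%Z
  else if (n <=? a + b - c)%Z then (a + b - c - n)%Z else (a + b - c)%Z.

Definition col (x : Z) : bool := (0 <=? x)%Z && (x <? n)%Z.

(** Congruence modulo [m] for representatives in [[0, 3m)]: equality of cosets of [{0, m, 2m}]. *)
Definition same (a b : Z) : bool :=
  [|| a == b, a == (b + m)%Z, b == (a + m)%Z, a == (b + 2 * m)%Z | b == (a + 2 * m)%Z].

Lemma colP x : reflect (0 <= x < n)%Z (col x).
Proof. by apply: (iffP andP) => [[/Z.leb_spec0 ? /Z.ltb_spec0 ?]|[? ?]]; split; lia. Qed.

Lemma sameP a b :
  reflect (a = b \/ a = b + m \/ b = a + m \/ a = b + 2 * m \/ b = a + 2 * m)%Z (same a b).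
Proof.
apply: (iffP idP); rewrite /same.
  by case/or4P => [/eqP|/eqP|/eqP|/orP[]/eqP]; tauto.
by case=> [->|[->|[->|[->|->]]]]; rewrite !eqxx ?orbT.
Qed.

Ltac no_test t :=
  lazymatch t with context [Z.ltb _ _] => fail | context [Z.leb _ _] => fail | _ => idtac end.

Ltac zcase := repeat match goal with
  | |- context [Z.ltb ?x ?y] => no_test x; no_test y; case: (Z.ltb_spec x y) => ?; cbv iota
  | |- context [Z.leb ?x ?y] => no_test x; no_test y; case: (Z.leb_spec x y) => ?; cbv iota
  end.

Lemma sdiffN x y : sdiff y x = (- sdiff x y)%Z.
Proof. by rewrite /sdiff; zcase; lia. Qed.

Lemma sdiff_neq0 x y : col x -> col y -> x <> y -> sdiff x y <> 0%Z.
Proof. by move=> /colP ? /colP ?; rewrite /sdiff; zcase; lia. Qed.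

Lemma mirror_col a b c : col a -> col b -> col c -> col (mirror a b c).
Proof. by move=> /colP ? /colP ? /colP ?; apply/colP; rewrite /mirror; zcase; lia. Qed.

Lemma mirrorC a b c : mirror a b c = mirror b a c.
Proof. by rewrite /mirror [(a + b)%Z]Z.add_comm. Qed.

Lemma mirrorK a b c : col a -> col b -> col c -> mirror a b (mirror a b c) = c.
Proof. by move=> /colP ? /colP ? /colP ?; rewrite /mirror; zcase; lia. Qed.

Lemma mirror_swap a b c d : col a -> col b -> col c -> mirror a b c = d -> mirror c d a = b.
Proof. by move=> /colP ? /colP ? /colP ? <-; rewrite /mirror; zcase; lia. Qed.

(** Both sides say that [c] is the midpoint of [a] and [b], that is, [a + b = 2c] modulo [3m]. *)
Lemma mirror_mid a b c : col a -> col b -> col c -> (mirror a b c == c) = (mirror c c a == b).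
Proof.
move=> /colP ? /colP ? /colP ?; rewrite /mirror; zcase;
  apply/eqP/eqP; lia.
Qed.

Lemma mirror_eq a b c : col a -> col b -> col c -> mirror a b c = a -> b = c.
Proof. by move=> /colP ? /colP ? /colP ?; rewrite /mirror; zcase; lia. Qed.

(* [a b d] extends to a word [x y z w] with [x + y = z + w] either by completing
   the pair [{a, b}] ([head_lt]) or by completing [{b, d}] ([tail_lt]); both compare
   [sdiff x y] with [sdiff z w] in the resulting word. *)
Definition head_lt (a b d : Z) : bool :=
  let e := mirror a b d in
  if (0 <? sdiff a b)%Z == (0 <? sdiff d e)%Z then (sdiff a b <? sdiff d e)%Z else (sdiff a b <? sdiff e d)%Z.

Definition tail_lt (a b d : Z) : bool :=
  let e := mirror b d a in
  if (0 <? sdiff a e)%Z == (0 <? sdiff b d)%Z then (sdiff a e <? sdiff b d)%Z else (sdiff e a <? sdiff b d)%Z.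

Lemma sdiff_mod x y : col x -> col y ->
  (- h <= sdiff x y <= h)%Z /\ exists k, sdiff x y = (x - y + k * n)%Z.
Proof.
move=> /colP ? /colP ?; rewrite /sdiff; zcase; split; try lia;
  [exists (-1)%Z|exists 1%Z|exists 0%Z]; lia.
Qed.

Lemma mirror_mod a b c : exists k, mirror a b c = (a + b - c + k * n)%Z.
Proof. by rewrite /mirror; zcase; [exists 1%Z|exists (-1)%Z|exists 0%Z]; lia. Qed.

(** [4h] is less than [2n = 4h + 2]. *)
Lemma small_multiple k v : v = (k * n)%Z -> (- (4 * h) <= v <= 4 * h)%Z ->
  (v = 0 \/ v = n \/ v = - n)%Z.
Proof.
move=> -> hv; have : (k = -1 \/ k = 0 \/ k = 1)%Z by nia.
by case=> [->|[->|->]]; lia.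
Qed.

(** This dichotomy makes the choice between the two completions of a triple consistent: whichever
    truth value is prescribed for the comparison, exactly one completion attains it. *)
Lemma head_tail_lt a b d : col a -> col b -> col d -> a <> b -> b <> d -> a <> d ->
  head_lt a b d = ~~ tail_lt a b d.
Proof.
move=> ca cb cd ab bd ad; rewrite /head_lt /tail_lt.
rewrite [sdiff (mirror a b d) d]sdiffN [sdiff (mirror b d a) a]sdiffN.
have [] := sdiff_mod ca cb; have [] := sdiff_mod cb cd; have [] := sdiff_mod ca cd.
have [] := sdiff_mod cd (mirror_col ca cb cd); have [] := sdiff_mod ca (mirror_col cb cd ca).
have [k1 e1] := mirror_mod a b d; have [k2 e2] := mirror_mod b d a.
have := sdiff_neq0 ca cb ab; have := sdiff_neq0 cb cd bd; have := sdiff_neq0 ca cd ad.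
move: (sdiff a b) (sdiff b d) (sdiff a d) (sdiff d (mirror a b d)) (sdiff a (mirror b d a)) => p r u V U.
rewrite {}e1 {}e2 => u0 r0 p0 hU [kU eU] hV [kV eV] hu [ku eu] hr [kr er] hp [kp ep].
(* Modulo [n], the differences satisfy [u = p + r], [V = - p - 2r] and [U = 2p + r]. The bounds
   leave three possible corrections for each, and linear arithmetic settles every combination. *)
have : (u - p - r = 0 \/ u - p - r = n \/ u - p - r = - n)%Z.
  by apply: (@small_multiple (ku - kp - kr)); [rewrite eu ep er; ring|lia].
have : (V + p + r + r = 0 \/ V + p + r + r = n \/ V + p + r + r = - n)%Z.
  by apply: (@small_multiple (kV - k1 + kp + kr + kr)); [rewrite eV ep er; ring|lia].
have : (U - p - p - r = 0 \/ U - p - p - r = n \/ U - p - p - r = - n)%Z.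
  by apply: (@small_multiple (kU - k2 - kp - kp - kr)); [rewrite eU ep er; ring|lia].
clear -mh m0 u0 r0 p0 hU hV hr hp hu.
by case=> [|[|]] ? [|[|]] ? [|[|]] ?; try (exfalso; lia);
  zcase; rewrite /=; zcase => //=; exfalso; lia.
Qed.

(** * Words whose columns meet several cosets of [{0, m, 2m}] *)

Definition majority (i j k : bool) : bool := (i && j) || (k && (i || j)).

Definition oriented (a b c d : Z) : bool := (0 <? sdiff a b)%Z == (0 <? sdiff c d)%Z.

Definition outer_dec (t : triple (Z * bool)) : word4 (Z * bool) :=
  let: ((a, i), (b, j), (d, k)) := t in
  if a == b then
    if i then
      let e := mirror a a d in
      if (0 <? sdiff e d)%Z == k then ((a, true), (a, false), (d, k), (e, k))
      else ((a, true), (a, false), (e, k), (d, k))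
    else ((d, k), (a, false), (a, true), (d, k))
  else if b == d then
    if j then
      let e := mirror b b a in
      if (0 <? sdiff e a)%Z == ~~ i then ((a, i), (e, i), (b, true), (b, false))
      else ((e, i), (a, i), (b, true), (b, false))
    else ((a, i), (b, false), (b, true), (a, i))
  else if a == d then
    if i == k then ((a, i), (b, false), (b, true), (a, i))
    else
      let e := mirror a a b in
      if (0 <? sdiff e b)%Z == i then ((a, i), (b, j), (e, ~~ j), (a, k))
      else ((a, i), (e, ~~ j), (b, j), (a, k))
  else
    let x := ~~ (i (+) j (+) k) in
    if head_lt a b d == ~~ majority i j k then
      let e := mirror a b d in
      if e == d then
        if i == j then ((a, i), (b, j), (d, true), (d, false))
        else ((d, ~~ k), (a, i), (b, j), (d, k))
      else if oriented a b d e then ((a, i), (b, j), (d, k), (e, x))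
      else ((a, i), (b, j), (e, x), (d, k))
    else
      let e := mirror b d a in
      if e == a then
        if j == k then ((a, true), (a, false), (b, j), (d, k))
        else ((a, i), (b, j), (d, k), (a, ~~ i))
      else if oriented a e b d then ((a, i), (e, x), (b, j), (d, k))
      else ((e, x), (a, i), (b, j), (d, k)).

(** The bits of [OuterQuad] have odd sum, so its four triples share one majority. In the next three
    families [o] is the midpoint of the other two columns, and the sign of their difference fixes
    their order or the bits. *)
Inductive outer : word4 (Z * bool) -> Prop :=
| OuterQuad x y z w i j k of col x & col y & col z & ~~ (same x y && same x z) &
    x <> y & x <> z & y <> z & mirror x y z = w & z <> w & oriented x y z w &
    (sdiff x y <? sdiff z w)%Z = ~~ majority i j k :
    outer ((x, i), (y, j), (z, k), (w, ~~ (i (+) j (+) k)))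
| OuterBridge o b d i of col o & col b & col d & ~~ same o b & mirror b d o = o :
    outer ((o, (0 <? sdiff d b)%Z), (b, i), (d, ~~ i), (o, ~~ (0 <? sdiff d b)%Z))
| OuterHead o b d of col o & col b & col d & ~~ same o b & mirror b d o = o :
    outer ((o, true), (o, false), (b, (0 <? sdiff d b)%Z), (d, (0 <? sdiff d b)%Z))
| OuterTail o a b of col o & col a & col b & ~~ same o a & mirror a b o = o :
    outer ((a, (0 <? sdiff a b)%Z), (b, (0 <? sdiff a b)%Z), (o, true), (o, false))
| OuterPair a s i of col a & col s & ~~ same a s :
    outer ((a, i), (s, false), (s, true), (a, i)).

Definition outer_triple (t : triple (Z * bool)) : bool :=
  let: ((a, _), (b, _), (c, _)) := t in
  [&& col a, col b, col c & ~~ (same a b && same a c)] && core_triple (@flip Z) t.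

Lemma same_sym a b : same a b = same b a.
Proof. by apply/sameP/sameP; lia. Qed.

Lemma same_refl a : same a a. Proof. by rewrite /same eqxx. Qed.

(** Here [b - o = o - a] modulo [3m], so [b] leaves the coset of [o] together with [a]; and [a = b]
    would give [a = o], as [3m] is odd. *)
Lemma mirror_neq a b o : col a -> col b -> col o -> ~~ same o a -> mirror a b o = o ->
  [/\ a <> b, o <> a, o <> b & ~~ same o b].
Proof.
move=> ca cb co /sameP na; rewrite /mirror.
move/colP: ca => ?; move/colP: cb => ?; move/colP: co => ?.
by zcase => ?; split; try lia; apply/sameP; lia.
Qed.

Lemma sdiff_gt0N x y : col x -> col y -> x <> y -> (0 <? sdiff y x)%Z = ~~ (0 <? sdiff x y)%Z.
Proof.
move=> cx cy xy; have := sdiff_neq0 cx cy xy; rewrite [sdiff y x]sdiffN; move: (sdiff x y) => p p0.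
by case: (Z.ltb_spec 0 p) => ?; case: (Z.ltb_spec 0 (- p)) => ? //; exfalso; lia.
Qed.

Lemma same_mod a b : col a -> col b -> reflect (exists k, a - b = k * m)%Z (same a b).
Proof.
move=> /colP ? /colP ?; apply: (iffP (sameP a b)) => [|[k e]].
  case=> [?|[?|[?|[?|?]]]]; [exists 0%Z|exists 1%Z|exists (-1)%Z|exists 2%Z|exists (-2)%Z]; lia.
have : (k = -2 \/ k = -1 \/ k = 0 \/ k = 1 \/ k = 2)%Z by nia.
by case=> [?|[?|[?|[?|?]]]]; subst k; lia.
Qed.

Lemma same_mirror a b c : col a -> col b -> col c -> same a b -> same a c = same a (mirror a b c).
Proof.
move=> ca cb cc /(same_mod ca cb)[k e]; have [l el] := mirror_mod a b c.
have cr := mirror_col ca cb cc.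
apply/(same_mod ca cc)/(same_mod ca cr) => -[r er].
  by exists (k - r - 3 * l)%Z; rewrite el; lia.
by exists (k - r - 3 * l)%Z; move: er; rewrite el; lia.
Qed.

Lemma outer_quad x y z w i j k t : col x -> col y -> col z -> ~~ (same x y && same x z) ->
    x <> y -> x <> z -> y <> z -> mirror x y z = w -> z <> w -> oriented x y z w ->
    (sdiff x y <? sdiff z w)%Z = ~~ majority i j k ->
  t \in subs ((x, i), (y, j), (z, k), (w, ~~ (i (+) j (+) k))) ->
  outer_triple t /\ outer_dec t = ((x, i), (y, j), (z, k), (w, ~~ (i (+) j (+) k))).
Proof.
move=> cx cy cz ng xy xz yz ew zw ori lt.
have cw : col w by rewrite -ew mirror_col.
have e1 : mirror x y w = z by rewrite -ew mirrorK.
have e2 : mirror z w x = y by apply: mirror_swap ew.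
have e3 : mirror z w y = x by apply: mirror_swap cy cx cz _; rewrite mirrorC.
have xw : x <> w by move=> xw; apply: yz; apply: mirror_eq cx cy cz _; rewrite ew.
have yw : y <> w by move=> yw; apply: xz; apply: mirror_eq cy cx cz _; rewrite mirrorC ew.
have ori' : oriented x y w z = false.
  by move: ori; rewrite /oriented (sdiff_gt0N cz cw zw); do 2 case: (0 <? _)%Z.
have orr : oriented y x z w = false.
  by move: ori; rewrite /oriented (sdiff_gt0N cx cy xy); do 2 case: (0 <? _)%Z.
(* If one of the remaining triples lay in a single coset, [x + y = z + w] would bring the fourth
   column into it. *)
have ng2 : ~~ (same x y && same x w).
  by apply: contra ng => /andP[sxy]; rewrite sxy (same_mirror cx cy cz sxy) ew.
have [l el] := mirror_mod x y z; rewrite ew in el.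
have ng3 : ~~ (same x z && same x w).
  apply: contra ng => /andP[sxz /(same_mod cx cw)[k2 e5]]; rewrite sxz andbT.
  by case/(same_mod cx cz): sxz => k1 e4; apply/(same_mod cx cy);
  exists (k1 + k2 + 3 * l)%Z; clear -e4 e5 el; lia.
have ng4 : ~~ (same y z && same y w).
  apply: contra ng => /andP[/(same_mod cy cz)[k1 e4] /(same_mod cy cw)[k2 e5]]; apply/andP; split.
    by apply/(same_mod cx cy); exists (- k1 - k2 - 3 * l)%Z; clear -e4 e5 el; lia.
  by apply/(same_mod cx cz); exists (- k2 - 3 * l)%Z; clear -e4 e5 el; lia.
have hl1 : head_lt x y z = (sdiff x y <? sdiff z w)%Z.
  by rewrite /head_lt ew -/(oriented x y z w) ori.
have hl2 : head_lt x y w = (sdiff x y <? sdiff z w)%Z.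
  by rewrite /head_lt e1 -/(oriented x y w z) ori'.
(* In the last two triples [z] and [w] form the complete pair, so [tail_lt] reads the comparison of
   the word and [head_lt] its negation. *)
have hl3 : head_lt x z w = ~~ (sdiff x y <? sdiff z w)%Z.
  by rewrite head_tail_lt // /tail_lt e2 -/(oriented x y z w) ori.
have hl4 : head_lt y z w = ~~ (sdiff x y <? sdiff z w)%Z.
  by rewrite head_tail_lt // /tail_lt e3 -/(oriented y x z w) orr.
move/eqP/negPf: xy => xy; move/eqP/negPf: xz => xz; move/eqP/negPf: yz => yz.
move/eqP/negPf: zw => zw; move/eqP/negPf: xw => xw; move/eqP/negPf: yw => yw.
have yx : (y == x) = false by rewrite eq_sym.
have wz : (w == z) = false by rewrite eq_sym.
rewrite !inE => /or4P[]/eqP->; rewrite /outer_triple /= !xpair_eqE ?cx ?cy ?cz ?cw ?ng ?ng2 ?ng3 ?ng4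
  ?xy ?xz ?yz ?zw ?xw ?yw /=; split=> //;
  rewrite ?hl1 ?hl2 ?hl3 ?hl4 lt ?ew ?e1 ?e2 ?e3 ?ori ?ori' ?orr ?yx ?wz ?zw ?xy ?eqxx /=.
all: by move: i j k {lt} => [] [] []; rewrite ?eqxx.
Qed.

Lemma sdiffxx x : sdiff x x = 0%Z.
Proof. by rewrite /sdiff Z.sub_diag; zcase; lia. Qed.

(** The completion repeats [o], so the second difference is 0 and the comparison becomes a sign. *)
Lemma head_lt_mid a b o : mirror a b o = o -> head_lt a b o = (0 <? sdiff b a)%Z.
Proof.
rewrite /head_lt => ->; rewrite sdiffxx if_same [sdiff b a]sdiffN.
by move: (sdiff a b) => p; zcase => //; lia.
Qed.

Lemma tail_lt_mid o b d : mirror b d o = o -> tail_lt o b d = (0 <? sdiff b d)%Z.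
Proof. by rewrite /tail_lt => ->; rewrite sdiffxx if_same. Qed.

Lemma neq_false (a b : Z) : a <> b -> (a == b) = false /\ (b == a) = false.
Proof. by move=> /eqP/negPf ab; rewrite [b == a]eq_sym. Qed.

(** Together with [outer_dec_outer] this shows that the outer words partition the outer triples. *)
Lemma outer_wordP w t : outer w -> t \in subs w -> outer_triple t /\ outer_dec t = w.
Proof.
case=> {w} [x y z w i j k|o b d i|o b d|o a b|a s i].
- exact: outer_quad.
- move=> co cb cd nob mid; have [bd ob od nod] := mirror_neq cb cd co nob mid.
  have [mb md] : mirror o o b = d /\ mirror o o d = b.
    by split; apply/eqP; [rewrite -mirror_mid // mid | rewrite -mirror_mid // mirrorC mid].
  have hl : head_lt o b d = (0 <? sdiff d b)%Z.
    by rewrite head_tail_lt ?tail_lt_mid // (sdiff_gt0N cd cb) ?negbK //; apply/nesym.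
  have hb := head_lt_mid mid.
  have [{}ob bo] := neq_false ob; have [{}od do'] := neq_false od.
  have kb := sdiff_gt0N cd cb (nesym bd); have [{}bd db] := neq_false bd.
  by rewrite !inE => /or4P[]/eqP->; rewrite /outer_triple /= !xpair_eqE ?co ?cb ?cd
    ?(negPf nob) ?(negPf nod) ?[same b o]same_sym ?[same d o]same_sym ?(negPf nob) ?(negPf nod)
    ?ob ?bo ?od ?do' ?bd ?db ?eqxx ?hl ?hb ?mb ?md ?mid ?kb ?eqxx ?andbF /=; split=> //;
  move: (0 <? sdiff d b)%Z => c; case: c; case: i.
- move=> co cb cd nob mid; have [bd ob od nod] := mirror_neq cb cd co nob mid.
  have [mb md] : mirror o o b = d /\ mirror o o d = b.
    by split; apply/eqP; [rewrite -mirror_mid // mid | rewrite -mirror_mid // mirrorC mid].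
  have hl : head_lt o b d = (0 <? sdiff d b)%Z.
    by rewrite head_tail_lt ?tail_lt_mid // (sdiff_gt0N cd cb) ?negbK //; apply/nesym.
  have [{}ob bo] := neq_false ob; have [{}od do'] := neq_false od.
  have kb := sdiff_gt0N cd cb (nesym bd); have [{}bd db] := neq_false bd.
  by rewrite !inE => /or4P[]/eqP->; rewrite /outer_triple /= !xpair_eqE ?co ?cb ?cd
    ?(negPf nob) ?(negPf nod) ?[same b o]same_sym ?[same d o]same_sym ?(negPf nob) ?(negPf nod)
    ?ob ?bo ?od ?do' ?bd ?db ?eqxx ?hl ?mb ?md ?mid ?kb ?eqxx ?andbF /=; split=> //;
  move: (0 <? sdiff d b)%Z => c; case: c.
- move=> co ca cb noa mid; have [ab oa ob nob] := mirror_neq ca cb co noa mid.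
  have [ma mb] : mirror o o a = b /\ mirror o o b = a.
    by split; apply/eqP; [rewrite -mirror_mid // mid | rewrite -mirror_mid // mirrorC mid].
  have hb := head_lt_mid mid.
  have [{}oa ao] := neq_false oa; have [{}ob bo] := neq_false ob.
  have kb := sdiff_gt0N ca cb ab; have [{}ab ba] := neq_false ab.
  by rewrite !inE => /or4P[]/eqP->; rewrite /outer_triple /= !xpair_eqE co ?ca ?cb
    ?[same a o]same_sym ?[same b o]same_sym ?(negPf noa) ?(negPf nob)
    ?ob ?bo ?oa ?ao ?ab ?ba ?eqxx ?hb ?ma ?mb ?mid ?kb ?eqxx ?andbF /=; split=> //;
  move: (0 <? sdiff a b)%Z => c; case: c.
- move=> ca cs nas.
  have as_ : a <> s by move=> e; move: nas; rewrite e same_refl.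
  have [{}as_ sa] := neq_false as_.
  by rewrite !inE => /or4P[]/eqP->; rewrite /outer_triple /= !xpair_eqE ca cs
    ?[same s a]same_sym ?(negPf nas) ?as_ ?sa ?eqxx ?andbF /=; split=> //.
Qed.

(** Here and in the next two lemmas the sign bit is a variable tied by an equation, so that the
    constructor applies whatever form the bit takes. *)
Lemma outer_bridge o b d k i : col o -> col b -> col d -> ~~ same o b -> mirror b d o = o ->
  k = (0 <? sdiff d b)%Z -> outer ((o, k), (b, i), (d, ~~ i), (o, ~~ k)).
Proof. by move=> ? ? ? ? ? ->; apply: OuterBridge. Qed.

Lemma outer_head o b d k : col o -> col b -> col d -> ~~ same o b -> mirror b d o = o ->
  k = (0 <? sdiff d b)%Z -> outer ((o, true), (o, false), (b, k), (d, k)).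
Proof. by move=> ? ? ? ? ? ->; apply: OuterHead. Qed.

Lemma outer_tail o a b k : col o -> col a -> col b -> ~~ same o a -> mirror a b o = o ->
  k = (0 <? sdiff a b)%Z -> outer ((a, k), (b, k), (o, true), (o, false)).
Proof. by move=> ? ? ? ? ? ->; apply: OuterTail. Qed.

Lemma mirror_facts o a : col o -> col a -> ~~ same o a ->
  let e := mirror o o a in
  [/\ col e, mirror a e o = o, mirror e a o = o, ~~ same o e & (0 <? sdiff a e)%Z = ~~ (0 <? sdiff e a)%Z].
Proof.
move=> co ca noa e; have ce : col e by rewrite mirror_col.
have m1 : mirror a e o = o by apply/eqP; rewrite mirror_mid.
have [ae _ _ noe] := mirror_neq ca ce co noa m1.
split=> //; first by rewrite mirrorC.
by rewrite (sdiff_gt0N ce ca) //; apply/nesym.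
Qed.

Lemma quad_facts a b d (e := mirror a b d) :
  col a -> col b -> col d -> a <> b -> b <> d -> a <> d -> e <> d ->
  [/\ col e, a <> e, b <> e & [/\ mirror a b e = d, mirror d e a = b & mirror d e b = a]].
Proof.
move=> ca cb cd ab bd ad ed; have ce : col e by apply: mirror_col.
have ba : mirror b a d = e by rewrite mirrorC.
split=> //; [| |split].
- by move=> ae; apply: bd; apply: mirror_eq ca cb cd _; rewrite -/e.
- by move=> be; apply: ad; apply: mirror_eq cb ca cd _; rewrite ba.
- exact: mirrorK.
- exact: mirror_swap.
- exact: mirror_swap ba.
Qed.

(** Among four bits of odd sum, one or three are set, so any three of them have the same
    majority. *)
Lemma majority_parity i j k : majority i j (~~ (i (+) j (+) k)) = majority i j k.
Proof. by case: i; case: j; case: k. Qed.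

Lemma parityK i j k : ~~ (i (+) j (+) ~~ (i (+) j (+) k)) = k.
Proof. by case: i; case: j; case: k. Qed.

(** Exchanging [d] and [e] reverses the sign of their difference, so one of the two orders is
    oriented like [a], [b]. *)
Lemma outer_quad_head a b d i j k (e := mirror a b d) (x := ~~ (i (+) j (+) k)) :
  col a -> col b -> col d -> ~~ (same a b && same a d) -> a <> b -> b <> d -> a <> d -> e <> d ->
  head_lt a b d = ~~ majority i j k ->
  outer (if oriented a b d e then ((a, i), (b, j), (d, k), (e, x))
         else ((a, i), (b, j), (e, x), (d, k))).
Proof.
move=> ca cb cd ng ab bd ad ed hl.
have [ce ae be [e1 e2 e3]] := quad_facts ca cb cd ab bd ad ed.
case: ifP => ori; first apply: OuterQuad => //; first by apply/nesym.
  by rewrite -hl /head_lt -/e -/(oriented a b d e) ori.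
have {1}-> : k = ~~ (i (+) j (+) x) by rewrite parityK.
apply: OuterQuad => //.
- by apply: contra ng => /andP[sab]; rewrite sab (same_mirror ca cb cd sab).
- by move: ori; rewrite /oriented (sdiff_gt0N cd ce (nesym ed)); do 2 case: (0 <? _)%Z.
- by rewrite majority_parity -hl /head_lt -/e -/(oriented a b d e) ori.
Qed.

Lemma outer_quad_tail a b d i j k (e := mirror b d a) (x := ~~ (i (+) j (+) k)) :
  col a -> col b -> col d -> ~~ (same a b && same a d) -> a <> b -> b <> d -> a <> d -> e <> a ->
  tail_lt a b d = ~~ majority i j k ->
  outer (if oriented a e b d then ((a, i), (e, x), (b, j), (d, k))
         else ((e, x), (a, i), (b, j), (d, k))).
Proof.
move=> ca cb cd ng ab bd ad ea tl.
have [ce be de [e1 e2 e3]] := quad_facts cb cd ca bd (nesym ad) (nesym ab) ea.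
have [l el] := mirror_mod b d a; rewrite -/e in el.
case: ifP => ori.
  have {1}-> : k = ~~ (i (+) x (+) j) by rewrite /x; clear; case: i; case: j; case: k.
  apply: OuterQuad => //; try exact/nesym.
  - apply: contra ng => /andP[/(same_mod ca ce)[r1 h1] sab]; rewrite sab /=.
    case/(same_mod ca cb): sab => r2 h2; apply/(same_mod ca cd).
    by exists (r1 - r2 + 3 * l)%Z; clear -h1 h2 el; lia.
  - rewrite -(_ : majority i j k = majority i x j); last by rewrite /x; clear; case: i; case: j; case: k.
    by rewrite -tl /tail_lt -/e -/(oriented a e b d) ori.
have {1}-> : k = ~~ (x (+) i (+) j) by rewrite /x; clear; case: i; case: j; case: k.
apply: OuterQuad => //; try exact/nesym.
- apply: contra ng => /andP[/(same_mod ce ca)[r1 h1] /(same_mod ce cb)[r2 h2]].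
  apply/andP; split; [apply/(same_mod ca cb)|apply/(same_mod ca cd)].
    by exists (r2 - r1)%Z; clear -h1 h2; lia.
  by exists (- r2 + 3 * l)%Z; clear -h1 h2 el; lia.
- by rewrite mirrorC.
- have sN : (0 <? sdiff e a)%Z = ~~ (0 <? sdiff a e)%Z by apply: sdiff_gt0N => //; exact/nesym.
  by move: ori; rewrite /oriented sN; do 2 case: (0 <? _)%Z.
- rewrite -(_ : majority i j k = majority x i j); last by rewrite /x; clear; case: i; case: j; case: k.
  by rewrite -tl /tail_lt -/e -/(oriented a e b d) ori.
Qed.

Lemma outer_dec_outer t : outer_triple t -> outer (outer_dec t) /\ t \in subs (outer_dec t).
Proof.
case: t => [[[a i] [b j]] [d k]] /andP[/and4P[ca cb cd ng]] /and3P[ab bd exc].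
rewrite /outer_dec; have [eab|nab] := eqVneq a b; last have [ebd|nbd] := eqVneq b d;
  last have [ead|nad] := eqVneq a d.
- subst b; rewrite same_refl /= in ng.
  have ij : j = ~~ i by move: ab; rewrite xpair_eqE eqxx; case: i j {bd exc} => [] [].
  subst j; have [ce m1 m2 ne sN] := mirror_facts ca cd ng.
  case: i {ab bd exc} => /=; last first.
    by split; [apply: OuterPair; rewrite 1?same_sym|rewrite !inE eqxx ?orbT].
  case: eqP => [ek|/eqP ek]; (split; last by rewrite !inE eqxx ?orbT); apply: outer_head => //.
  by rewrite sN; move: ek; case: (0 <? _)%Z; case: k.
- subst d; have nba : ~~ same b a by rewrite same_sym; move: ng; rewrite andbb.
  have jk : k = ~~ j by move: bd; rewrite xpair_eqE eqxx; case: j k {ab exc} => [] [].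
  subst k; have [ce m1 m2 ne sN] := mirror_facts cb ca nba.
  case: j {ab bd exc} => /=; last first.
    by split; [apply: OuterPair; rewrite 1?same_sym|rewrite !inE eqxx ?orbT].
  case: eqP => [ek|/eqP ek]; (split; last by rewrite !inE eqxx ?orbT); apply: outer_tail => //.
    by rewrite sN ek negbK.
  by move: ek; case: (0 <? _)%Z; case: i.
- clear ab bd exc; subst d; rewrite same_refl andbT in ng; have [ce m1 m2 ne sN] := mirror_facts ca cb ng.
  case: eqP => [eik|/eqP nik].
    subst k; split; first exact: OuterPair.
    by case: j; rewrite !inE eqxx ?orbT.
  have ki : k = ~~ i by move: nik; clear; case: i; case: k.
  subst k; case: eqP => [ek|/eqP ek]; (split; last by rewrite !inE eqxx ?orbT).
    by apply: outer_bridge.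
  rewrite -{2}[j]negbK; apply: outer_bridge => //.
  by rewrite sN; move: ek; clear; case: (0 <? _)%Z; case: i.
- clear ab bd exc; have nab' := elimN eqP nab; have nbd' := elimN eqP nbd; have nad' := elimN eqP nad.
  have tl := head_tail_lt ca cb cd nab' nbd' nad'.
  case: eqP => [hl|/eqP nhl].
    case: eqP => [e1|ne1].
      have hb := head_lt_mid e1.
      (* From [b = 2d - a], a coset common to [a] and [d] would contain [b]. *)
      have noa : ~~ same d a.
        apply: contra ng => sda; have sad : same a d by rewrite same_sym.
        rewrite sad andbT; have /(same_mod cd ca)[r er] := sda; have [l el] := mirror_mod a b d.
        rewrite e1 in el; apply/(same_mod ca cb); exists (- 2 * r + 3 * l)%Z.
        by clear -er el; lia.
      have sN := sdiff_gt0N ca cb nab'.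
      case: eqP => [eij|/eqP nij].
        subst j; split; last by clear; case: k; rewrite !inE eqxx ?orbT.
        apply: outer_tail => //; move: hl; rewrite hb sN.
        by clear; case: (0 <? _)%Z; case: i; case: k.
      have ij : j = ~~ i by move: nij; clear; case: i; case: j.
      subst j; split; last by rewrite !inE eqxx ?orbT.
      rewrite -{2}[k]negbK; apply: outer_bridge => //; move: hl; rewrite hb sN.
      by clear; case: (0 <? _)%Z; case: i; case: k.
    split; first exact: outer_quad_head.
    by case: ifP => _; rewrite !inE eqxx ?orbT.
  (* The head completion has the wrong order for these bits, so by [head_tail_lt] the tail
     completion has the right one. *)
  have {nhl} hl : tail_lt a b d = ~~ majority i j k.
    by move: nhl; rewrite tl; case: tail_lt; case: majority.
  case: eqP => [e2|ne2]; last first.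
    split; first exact: outer_quad_tail.
    by case: ifP => _; rewrite !inE eqxx ?orbT.
  have nab2 : ~~ same a b.
    apply: contra ng => sab; rewrite sab /=.
    have /(same_mod ca cb)[r er] := sab; have [l el] := mirror_mod b d a.
    rewrite e2 in el; apply/(same_mod ca cd); exists (- r + 3 * l)%Z.
    by clear -er el; lia.
  have hb := tail_lt_mid e2; have sN := sdiff_gt0N cb cd nbd'.
  case: eqP => [ejk|/eqP njk].
    subst k; split; last by clear; case: i; rewrite !inE eqxx ?orbT.
    apply: outer_head => //; move: hl; rewrite hb sN.
    by clear; case: (0 <? _)%Z; case: i; case: j.
  have jk : k = ~~ j by move: njk; clear; case: j; case: k.
  subst k; split; last by rewrite !inE eqxx ?orbT.
  apply: outer_bridge => //; move: hl; rewrite hb sN.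
  by clear; case: (0 <? _)%Z; case: i; case: j.
Qed.

(** * Words inside one coset of [{0, m, 2m}] *)

Definition six_points : seq (Z * bool) :=
  [seq (c, i) | c <- [:: 0; 1; 2]%Z, i <- [:: false; true]].

Definition six_rotate (x : Z * bool) : Z * bool :=
  ((if x.1 == 2 then 0 else x.1 + 1)%Z, x.2).

(* Found by computer search among the codes invariant under [six_rotate]. *)
Definition six_words : seq (word4 (Z * bool)) :=
  [seq iter r (map4 six_rotate) w | r <- iota 0 3, w <-
   [:: ((0%Z, false), (2%Z, false), (1%Z, true), (0%Z, false));
      ((0%Z, false), (1%Z, false), (2%Z, true), (0%Z, false));
      ((0%Z, true), (1%Z, false), (2%Z, true), (0%Z, true));
      ((0%Z, true), (2%Z, false), (1%Z, true), (0%Z, true));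
      ((0%Z, true), (0%Z, false), (2%Z, true), (2%Z, false));
      ((0%Z, false), (1%Z, false), (0%Z, true), (1%Z, true));
      ((0%Z, false), (2%Z, false), (0%Z, true), (2%Z, true));
      ((0%Z, true), (0%Z, false), (1%Z, true), (1%Z, false));
      ((0%Z, true), (1%Z, true), (2%Z, false), (2%Z, true));
      ((0%Z, true), (2%Z, true), (1%Z, true), (0%Z, false));
      ((0%Z, false), (0%Z, true), (2%Z, false), (1%Z, false));
      ((0%Z, true), (1%Z, false), (2%Z, false), (0%Z, false))]].

(** This and the next three computations say that the 36 words form a core code on six letters. *)
Lemma six_letters : all (all4 (fun x => x \in six_points)) six_words.
Proof. by vm_compute. Qed.

Lemma six_core : all (fun w => all (core_triple (@flip Z)) (subs w)) six_words.
Proof. by vm_compute. Qed.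

Lemma six_cover : all (fun a => all (fun b => all (fun c =>
  core_triple (@flip Z) (a, b, c) ==> has (fun w => (a, b, c) \in subs w) six_words)
  six_points) six_points) six_points.
Proof. by vm_compute. Qed.

Lemma six_disjoint : all (fun x => all (fun y =>
  (x == y) || ~~ has (fun t => t \in subs y) (subs x)) six_words) six_words.
Proof. by vm_compute. Qed.

Definition coset_point (r : Z) (x : Z * bool) : Z * bool := ((r + m * x.1)%Z, x.2).

Definition res (x : Z) : Z :=
  if (x <? m)%Z then x else if (x <? 2 * m)%Z then (x - m)%Z else (x - 2 * m)%Z.

Definition inner_word (w : word4 (Z * bool)) : bool :=
  let: (p, _, _, _) := w in col p.1 && (w \in map (map4 (coset_point (res p.1))) six_words).

(** A boolean counterpart of [outer], phrased through the decoder so that disjointness is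
    immediate. *)
Definition outer_word (w : word4 (Z * bool)) : bool :=
  all (fun t => outer_triple t && (outer_dec t == w)) (subs w).

Definition base_word (w : word4 (Z * bool)) : bool := inner_word w || outer_word w.

Lemma coset_point_inj r : injective (coset_point r).
Proof.
move=> [x i] [y j] [e ->]; congr (_, _).
by apply: (Z.mul_reg_l _ _ m); [clear -m0; lia|clear -e; lia].
Qed.

Lemma coset_point_core r t : core_triple (@flip Z) (map3 (coset_point r) t) = core_triple (@flip Z) t.
Proof.
case: t => [[a b] c]; rewrite /= !(inj_eq (@coset_point_inj r)).
by rewrite -[flip (coset_point r a)]/(coset_point r (flip a)) (inj_eq (@coset_point_inj r)).
Qed.

Lemma six_point_digit x : x \in six_points -> (x.1 = 0 \/ x.1 = 1 \/ x.1 = 2)%Z.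
Proof. by rewrite !inE; do ! case/orP; move/eqP=> ->; tauto. Qed.

Lemma res_coset_point r x : (0 <= r < m)%Z -> x \in six_points -> res (coset_point r x).1 = r /\ col (coset_point r x).1.
Proof.
case: x => c i hr /six_point_digit; rewrite -[(c, i).1]/c -[(coset_point _ _).1]/(r + m * c)%Z.
move=> hc; split; first by rewrite /res; case: hc => [->|[->|->]]; zcase; lia.
by apply/colP; case: hc => [->|[->|->]]; lia.
Qed.

Lemma res_bound x : col x -> (0 <= res x < m)%Z.
Proof. by move=> /colP ?; rewrite /res; zcase; lia. Qed.

Lemma inner_wordP w : inner_word w ->
  exists r v, [/\ (0 <= r < m)%Z, v \in six_words & w = map4 (coset_point r) v].
Proof.
case: w => [[[p q] r] s] /andP[cp /mapP[v v6 e]]; exists (res p.1), v; split=> //.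
exact: res_bound.
Qed.

Lemma coset_word_inner r v : (0 <= r < m)%Z -> v \in six_words -> inner_word (map4 (coset_point r) v).
Proof.
move=> hr v6; have := allP six_letters _ v6.
case: v v6 => [[[p q] s] t] v6 /and4P[p6 _ _ _].
have [e c] := res_coset_point hr p6; apply/andP; split; first exact: c.
by rewrite -/(map4 (coset_point r) (p, q, s, t)) e map_f.
Qed.

Lemma same_res a : col a -> exists2 c, c \in [:: 0; 1; 2]%Z & a = (res a + m * c)%Z.
Proof.
move=> /colP ca; rewrite /res; zcase; [exists 0%Z|exists 1%Z|exists 2%Z]; rewrite ?inE //; lia.
Qed.

Lemma same_resE a b : col a -> col b -> same a b -> res b = res a.
Proof. by move=> /colP ? /colP ? /sameP; rewrite /res; zcase; lia. Qed.

Lemma coset_point_eq_res r r' x y : (0 <= r < m)%Z -> (0 <= r' < m)%Z ->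
  x \in six_points -> y \in six_points -> coset_point r x = coset_point r' y -> r = r'.
Proof.
move=> hr hr' x6 y6 e; have [<- _] := res_coset_point hr x6.
by rewrite e; have [-> _] := res_coset_point hr' y6.
Qed.

Lemma same_coset_point r x y : (0 <= r < m)%Z -> x \in six_points -> y \in six_points ->
  same (coset_point r x).1 (coset_point r y).1.
Proof.
move=> hr x6 y6; have [_ cx] := res_coset_point hr x6; have [_ cy] := res_coset_point hr y6.
case: x y {x6 y6} cx cy => [c i] [d j] cx cy; apply/same_mod => //.
by exists (c - d)%Z; rewrite -[(coset_point _ (c, i)).1]/(r + m * c)%Z -[(coset_point _ (d, j)).1]/(r + m * d)%Z; ring.
Qed.

Lemma subs_all4 (T : eqType) (P : T -> bool) w a b c :
  all4 P w -> (a, b, c) \in subs w -> [/\ P a, P b & P c].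
Proof.
by case: w => [[[p q] r] s] /and4P[? ? ? ?]; rewrite !inE => /or4P[]/eqP[-> -> ->].
Qed.

Lemma inner_not_outer w t : inner_word w -> t \in subs w -> ~~ outer_triple t.
Proof.
case/inner_wordP => r [v [hr v6 ->]]; rewrite subs_map4 => /mapP[[[x y] z] tv ->].
have [x6 y6 z6] := subs_all4 (allP six_letters _ v6) tv.
have s1 := same_coset_point hr x6 y6; have s2 := same_coset_point hr x6 z6.
rewrite /outer_triple /map3; case: (coset_point r x) (coset_point r y) (coset_point r z) s1 s2 => [a i] [b j] [c k] /= -> ->.
by rewrite !andbF.
Qed.

Lemma base_core_code : core_code (fun x => col x.1) (@flip Z) base_word.
Proof.
split.
- by move=> [a i] /= ca; rewrite /flip /= negbK xpair_eqE eqxx; split => //; case: i.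
- move=> w /orP[/inner_wordP[r [v [hr v6 ->]]]|].
    have := allP six_letters _ v6; case: v v6 => [[[p q] s] t] _ /and4P[p6 q6 s6 t6].
    have cl x : x \in six_points -> col (coset_point r x).1 by case/(res_coset_point hr).
    by rewrite /all4 /map4 !cl.
  case: w => [[[[a i] [b j]] [c k]] [d l]] /allP H.
  have /andP[/andP[/and4P[ca cb cc _] _] _] := H _ (mem_head _ _).
  have /andP[/andP[/and4P[_ _ cd _] _] _] := H ((a, i), (b, j), (d, l)) ltac:(by rewrite !inE eqxx orbT).
  by rewrite /= ca cb cc cd.
- move=> w t /orP[/inner_wordP[r [v [hr v6 ->]]]|/allP H tw]; last first.
    by have /andP[] := H _ tw; case: t {tw} => [[[a i] [b j]] [c k]] /andP[].
  rewrite subs_map4 => /mapP[u uv ->]; rewrite coset_point_core.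
  exact: allP (allP six_core _ v6) _ uv.
- move=> [a i] [b j] [c k] /= ca cb cc ct.
  (* A triple outside every coset is decoded; one inside a coset is the image of a triple on six
     letters under [coset_point (res a)]. *)
  have [/andP[sab sac]|ng] := boolP (same a b && same a c); last first.
    have ot : outer_triple ((a, i), (b, j), (c, k)) by rewrite /outer_triple ca cb cc ng.
    have [ow tw] := outer_dec_outer ot; exists (outer_dec ((a, i), (b, j), (c, k))) => //.
    apply/orP; right; apply/allP => t ts.
    by have [-> ->] := outer_wordP ow ts; rewrite eqxx.
  have [da da3 ea] := same_res ca; have [db db3 eb] := same_res cb; have [dc dc3 ec] := same_res cc.
  rewrite (same_resE ca cb sab) in eb; rewrite (same_resE ca cc sac) in ec.
  have hr := res_bound ca.
  have p6 (d : Z) (e : bool) : d \in [:: 0; 1; 2]%Z -> (d, e) \in six_points.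
    by rewrite !inE => /or3P[]/eqP->; case: e.
  have e3 : ((a, i), (b, j), (c, k)) = map3 (coset_point (res a)) ((da, i), (db, j), (dc, k)).
    by rewrite /map3 /coset_point /= -ea -eb -ec.
  move: ct; rewrite -/(core_triple (@flip Z) ((a, i), (b, j), (c, k))) e3 coset_point_core => ct.
  have /allP/(_ _ (p6 _ j db3))/allP/(_ _ (p6 _ k dc3))/implyP/(_ ct)/hasP[v v6 tv] :=
    allP six_cover _ (p6 _ i da3).
  exists (map4 (coset_point (res a)) v); first by rewrite /base_word coset_word_inner.
  by rewrite subs_map4; exact: map_f.
- move=> x y t /orP[Ix|/allP Ox] /orP[Iy|/allP Oy] tx ty.
  + have [r [v [hr v6 ex]]] := inner_wordP Ix; have [r' [v' [hr' v6' ey]]] := inner_wordP Iy.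
    move: tx ty; rewrite {}ex {}ey !subs_map4 => /mapP[u uv et] /mapP[u' uv' e]; subst t.
    have er : r = r'.
      case: u u' uv uv' e => [[a b] c] [[a' b'] c'] uv uv' /(congr1 (fun t => t.1.1)) e.
      have [x6 _ _] := subs_all4 (allP six_letters _ v6) uv.
      have [y6 _ _] := subs_all4 (allP six_letters _ v6') uv'.
      exact: coset_point_eq_res hr hr' x6 y6 e.
    subst r'; move/(map3_inj (@coset_point_inj r)): e => e; subst u'.
    have /allP/(_ _ v6')/orP[/eqP-> //|/hasPn/(_ _ uv)] := allP six_disjoint _ v6.
    by rewrite uv'.
  + by have := inner_not_outer Ix tx; have /andP[->] := Oy _ ty.
  + by have := inner_not_outer Iy ty; have /andP[->] := Ox _ tx.
  + by have /andP[_ /eqP<-] := Ox _ tx; have /andP[_ /eqP<-] := Oy _ ty.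
Qed.

End Base.

(** * Alphabets of every size [6m] *)

Lemma double_seq (T : eqType) (D : T -> bool) (s : seq T)
    (s2 := [seq (x, i) | x <- s, i <- [:: false; true]]) :
  uniq s -> s =i D -> [/\ uniq s2, s2 =i (fun x => D x.1) & size s2 = 2 * size s].
Proof.
move=> us sD; split.
- by apply: allpairs_uniq => // -[x i] [y j].
- move=> [x i]; rewrite -[RHS]/(D x) -[D x]sD; apply/allpairsP/idP => [[[y j] [ys _ [-> _]]] //|xs].
  by exists (x, i); split=> //; case: i.
- by rewrite size_allpairs mulnC.
Qed.

(** The base alphabet has [2 * 3m] letters, and [k] doublings supply the power of two. *)
Lemma core_code_exists (k m : nat) : odd m ->
  exists (T : eqType) (D : T -> bool) f W (s : seq T),
    [/\ core_code D f W, uniq s, s =i D & size s = 6 * (2 ^ k * m)].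
Proof.
move=> om; elim: k => [|k [T [D [f [W [s [cW us sD sz]]]]]]].
  pose M := Z.of_nat m; pose H := Z.of_nat (3 * m)./2.
  have mh : (3 * M = 2 * H + 1)%Z.
    by have := odd_double_half (3 * m); rewrite oddM om /M /H; lia.
  have m0 : (0 < M)%Z by rewrite /M; case: m om {M H mh} => // m _; lia.
  have us : uniq [seq Z.of_nat i | i <- iota 0 (3 * m)].
    by rewrite map_inj_uniq ?iota_uniq // => i j; lia.
  have sD : [seq Z.of_nat i | i <- iota 0 (3 * m)] =i col M.
    move=> x; apply/mapP/(colP M x) => [[i]|].
      by rewrite mem_iota /M => hi ->; lia.
    by move=> hx; exists (Z.to_nat x); rewrite ?mem_iota /M in hx *; lia.
  have [us2 sD2 sz2] := double_seq us sD.
  do 5 eexists; split; [exact: base_core_code mh m0|exact: us2|exact: sD2|].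
  by rewrite sz2 size_map size_iota expn0 mul1n mulnA.
have [us2 sD2 sz2] := double_seq us sD.
do 5 eexists; split; [exact: core_code_double cW|exact: us2|exact: sD2|].
by rewrite sz2 sz expnS; lia.
Qed.

Lemma odd_part (m : nat) : 0 < m -> exists k p, odd p /\ m = 2 ^ k * p.
Proof.
elim/ltn_ind: m => m IH m0; have [om|em] := boolP (odd m).
  by exists 0, m; rewrite mul1n.
have [||k [p [op e]]] := IH m./2; try lia.
by exists k.+1, p; split=> //; rewrite expnS -mulnA -e; lia.
Qed.

Theorem theorem4p3 (m : nat) (hm : 0 < m) :
  exists C : {set 4.-tuple 'I_(6 * m)},
    [/\ single_del_code C,
        #|C| = N1 4 (6 * m)
      & N1 4 (6 * m) = ((6 * m) ^ 2 * (6 * m + 2)) %/ 4].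
Proof.
have [k [p [op em]]] := odd_part hm.
have [T [D [f [W [s [cW us sD sz]]]]]] := core_code_exists k op.
rewrite -em in sz; have [f' [W' cW']] := core_code_ord cW us sD.
(* The types of [f'] and [W'] depend on [size s], so both are generalized before the size is
   rewritten. *)
move: f' W' cW'; rewrite sz => f' W' cW'.
by apply: (N1_of_core _ _ cW'); rewrite ?oddM //; lia.
Qed.
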